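(* For each variety $\mathbf{K}\in\Xi(\mathbf{S4})$, $$\mathsf{Log}(\sigma(\rho(\mathbf{K})))=Schem(\mathsf{Log}(\mathbf{K})^{\Box}).$$ Consequently, a logic (in the sense of axiomatic extension) $L\in\mathbf{NExt}(\mathsf{S4})$ is $\Box$-maximal if and only if it is the greatest modal companion of $\rho(L)$.
   Context: $\mathbf{S4}$ is the variety of S4-algebras: Boolean algebras with a unary $\Box$ satisfying $\Box1=1$, $\Box(a\wedge b)=\Box a\wedge\Box b$, $\Box a\le a$, $\Box a\le\Box\Box a$. In this statement $\Xi(\mathbf{S4})$ is the lattice of subvarieties of $\mathbf{S4}$. $\mathbf{NExt}(\mathsf{S4})$ is the lattice of normal axiomatic extensions of $\mathsf{S4}$ (sets of modal formulas), and $\Lambda(\mathsf{IPC})$ is the lattice of axiomatic extensions (superintuitionistic logics) of $\mathsf{IPC}$. For a class $\mathbf{K}$ of algebras, $\mathsf{Log}(\mathbf{K})$ is the set of formulas $\phi$ such that $\phi\approx1$ is valid in all members of $\mathbf{K}$. The translation $GMT$ from intuitionistic to modal formulas: $GMT(p)=\Box p$, $GMT(\top)=\top$, $GMT(\bot)=\bot$, $GMT$ commutes with $\wedge,\vee$, and $GMT(\phi\to\psi)=\Box(\neg GMT(\phi)\vee GMT(\psi))$. $M\in\mathbf{NExt}(\mathsf{S4})$ is a modal companion of $L\in\Lambda(\mathsf{IPC})$ if for all intuitionistic $\phi$: $\phi\in L\iff GMT(\phi)\in M$. For $M\in\mathbf{NExt}(\mathsf{S4})$, $\rho(M)=\{\phi:GMT(\phi)\in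 M\}\in\Lambda(\mathsf{IPC})$. For an S4-algebra $\mathcal{B}$, $\mathcal{B}_\Box=\{a\in B:a=\Box a\}$ is a Heyting algebra with the inherited $0,1,\wedge,\vee$ and implication $\Box(\neg a\vee b)$. For a variety $\mathbf{K}$ of S4-algebras, $\rho(\mathbf{K})=\{\mathcal{B}_\Box:\mathcal{B}\in\mathbf{K}\}$. For a Heyting algebra $\mathcal{H}$, $B(\mathcal{H})$ is its Boolean envelope: the Boolean algebra generated by $\mathcal{H}$, realized inside the powerset of the set of prime filters of $\mathcal{H}$ via $a\mapsto\{x:a\in x\}$, with $\Box\bigl(\bigwedge_{i=1}^n(\neg c_i\vee d_i)\bigr)=\bigwedge_{i=1}^n(c_i\to d_i)$ for $c_i,d_i\in H$, where $\to$ is Heyting implication; it is an S4-algebra. For a variety $\mathbf{P}$ of Heyting algebras, $\sigma(\mathbf{P})=\mathbb{HSP}\{B(\mathcal{H}):\mathcal{H}\in\mathbf{P}\}$. For $L\in\mathbf{NExt}(\mathsf{S4})$, its $\Box$-variant is $L^\Box=\{\phi:\phi[\Box\overline p/\overline p]\in L\}$, where $\phi[\Box\overline p/\overline p]$ substitutes $\Box q$ for each proposition letter $q$. For a $\Box$-variant $L'$, $Schem(L')=\{\phi:\forall\overline\psi,\ \phi[\overline\psi/\overline p]\in L'\}$, with $\overline\psi$ ranging over substitutions of modal formulas for proposition letters. $L$ is $\Box$-maximal if for every $S\in\mathbf{NExt}(\mathsf{S4})$, $L^\Box=S^\Box$ implies $S\subseteq L$. *)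

(* Defs.v *)
(* Mathematical Components, with the classical layer of MathComp-Analysis. *)
From HB Require Import structures.
From mathcomp Require Import all_boot all_order.
From mathcomp Require Import boolp classical_sets.

Set Implicit Arguments.
Unset Strict Implicit.
Unset Printing Implicit Defensive.

Import Order.Theory.
Local Open Scope order_scope.

(** * S4-algebras and Heyting algebras *)

(* Boolean algebras are [ctbDistrLatticeType]s; the trivial one (0 = 1) is
   allowed. *)
HB.mixin Record CTBDistrLattice_isS4 d T of Order.CTBDistrLattice d T := {
  box : T -> T;
  box1 : box \top = \top;
  boxI : forall a b : T, box (a `&` b) = box a `&` box b;
  box_le : forall a : T, box a <= a;
  box_le_box : forall a : T, box a <= box (box a)
}.

#[short(type="s4AlgType")]
HB.structure Definition S4Alg d :=
  { T of Order.CTBDistrLattice d T & CTBDistrLattice_isS4 d T }.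

HB.mixin Record TBDistrLattice_isHeyting d T of Order.TBDistrLattice d T := {
  himp : T -> T -> T;
  le_himp : forall a b c : T, (c <= himp a b) = (c `&` a <= b)
}.

#[short(type="heytingType")]
HB.structure Definition Heyting d :=
  { T of Order.TBDistrLattice d T & TBDistrLattice_isHeyting d T }.

Definition s4_hom d d' (A : s4AlgType d) (B : s4AlgType d') (f : A -> B) :=
  [/\ f \bot = \bot /\ f \top = \top,
      {morph f : a b / a `&` b}, {morph f : a b / a `|` b},
      {morph f : a / ~` a} & {morph f : a / box a}].

Definition heyting_hom d d' (H : heytingType d) (H' : heytingType d')
    (f : H -> H') :=
  [/\ f \bot = \bot /\ f \top = \top,
      {morph f : a b / a `&` b}, {morph f : a b / a `|` b} &
      {morph f : a b / himp a b}].

Definition heyting_iso d d' (H : heytingType d) (H' : heytingType d') :=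
  exists2 f : H -> H', heyting_hom f & bijective f.

(** * The Heyting algebra of box-fixed elements *)

Record opens d (B : s4AlgType d) :=
  Opens { opens_val : B; _ : opens_val == box opens_val }.

HB.instance Definition _ d (B : s4AlgType d) :=
  [isSub for @opens_val d B].
HB.instance Definition _ d (B : s4AlgType d) := [Choice of opens B by <:].

Section Opens.
Variables (d : Order.disp_t) (B : s4AlgType d).
Implicit Types a b : B.

Lemma box_idem a : box (box a) = box a.
Proof. by apply/eqP; rewrite eq_le box_le box_le_box. Qed.

Lemma le_box a b : a <= b -> box a <= box b.
Proof. by rewrite !leEmeet -boxI => /eqP ->. Qed.

Let fixed : pred B := fun a => a == box a.

Let fixed_meet : {in fixed &, forall a b, a `&` b \in fixed}.
Proof. by move=> a b /eqP ha /eqP hb; rewrite /fixed unfold_in boxI -ha -hb. Qed.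

Let fixed_join : {in fixed &, forall a b, a `|` b \in fixed}.
Proof.
move=> a b /eqP ha /eqP hb; rewrite /fixed unfold_in eq_le box_le andbT leUx.
by rewrite {1}ha {2}hb !le_box ?leUl ?leUr.
Qed.

Let fixed_bot : \bot \in fixed.
Proof. by rewrite /fixed unfold_in eq_le box_le le0x. Qed.

Let fixed_top : \top \in fixed.
Proof. by rewrite /fixed unfold_in box1. Qed.

HB.instance Definition _ := Order.SubChoice_isTBSubLattice.Build
  d B _ d (opens B) fixed_meet fixed_join fixed_bot fixed_top.

Lemma opens_valI (x y : opens B) : \val (x `&` y) = \val x `&` \val y.
Proof. by []. Qed.

Lemma opens_valU (x y : opens B) : \val (x `|` y) = \val x `|` \val y.
Proof. by []. Qed.

Lemma opens_val0 : \val (\bot : opens B) = \bot.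
Proof. by []. Qed.

Lemma opens_val1 : \val (\top : opens B) = \top.
Proof. by []. Qed.

Let opens_meetUl : @left_distributive (opens B) (opens B) Order.meet Order.join.
Proof.
by move=> x y z; apply: val_inj; rewrite !(opens_valI, opens_valU) meetUl.
Qed.

HB.instance Definition _ :=
  Order.Lattice_Meet_isDistrLattice.Build d (opens B) opens_meetUl.

Fact opens_imp_subproof (u v : opens B) :
  box (~` \val u `|` \val v) == box (box (~` \val u `|` \val v)).
Proof. by rewrite box_idem. Qed.

Definition opens_imp (u v : opens B) : opens B :=
  Opens (opens_imp_subproof u v).

Let le_opens_imp (u v w : opens B) : (w <= opens_imp u v) = (w `&` u <= v).
Proof.
rewrite -!Order.le_val opens_valI /=.
have <- : (\val w <= ~` \val u `|` \val v) = (\val w `&` \val u <= \val v).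
  by rewrite -leBLR diffE complK.
apply/idP/idP => [h|/le_box]; first exact: le_trans h (box_le _).
by case: w => w /= /eqP <-.
Qed.

HB.instance Definition _ :=
  TBDistrLattice_isHeyting.Build d (opens B) le_opens_imp.

Lemma opens_val_himp (x y : opens B) :
  \val (himp x y) = box (~` \val x `|` \val y).
Proof. by []. Qed.

End Opens.

(** * The Boolean envelope of a Heyting algebra *)

Record prime_filter d (H : heytingType d) := PrimeFilter {
  pf_set :> set H;
  pf_top : pf_set \top;
  pf_le : forall a b, a <= b -> pf_set a -> pf_set b;
  pf_meet : forall a b, pf_set a -> pf_set b -> pf_set (a `&` b);
  pf_bot : ~ pf_set \bot;
  pf_join : forall a b, pf_set (a `|` b) -> pf_set a \/ pf_set b
}.

Section Envelope.
Variables (d : Order.disp_t) (H : heytingType d).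
Implicit Types (a b c : H) (x : prime_filter H) (cs : seq (H * H)).
Implicit Types U V : set (prime_filter H).

Definition stone a : set (prime_filter H) := [set x | pf_set x a]%classic.

Inductive in_envelope : set (set (prime_filter H)) :=
| in_env_stone a : in_envelope (stone a)
| in_env_setI U V : in_envelope U -> in_envelope V -> in_envelope (U `&` V)%classic
| in_env_setU U V : in_envelope U -> in_envelope V -> in_envelope (U `|` V)%classic
| in_env_setC U : in_envelope U -> in_envelope (~` U)%classic.

(* The set denoted by the meet of the clauses (~ c \/ d), for (c, d) in [cs] *)
Definition clauses cs : set (prime_filter H) :=
  \big[setI/setT]_(cd <- cs) (~` stone cd.1 `|` stone cd.2)%classic.

Definition clauses_box cs : H := \meet_(cd <- cs) himp cd.1 cd.2.

Lemma stoneI a b : stone (a `&` b)%O = (stone a `&` stone b)%classic.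
Proof.
apply/seteqP; split=> x /=.
  by move=> h; split; apply: pf_le h; rewrite ?leIl ?leIr.
by case=> *; apply: pf_meet.
Qed.

Lemma stoneU a b : stone (a `|` b)%O = (stone a `|` stone b)%classic.
Proof.
apply/seteqP; split=> x /=; first exact: pf_join.
by case; apply: pf_le; rewrite ?leUl ?leUr.
Qed.

Lemma stone0 : stone \bot = set0.
Proof. by apply/seteqP; split=> x //= /pf_bot. Qed.

Lemma stone1 : stone \top = setT.
Proof. by apply/seteqP; split=> x // _; apply: pf_top. Qed.

Lemma clauses_cat cs cs' :
  clauses (cs ++ cs') = (clauses cs `&` clauses cs')%classic.
Proof. exact: big_cat. Qed.

Let is_cnf U := exists cs, U = clauses cs.

Let cnf_or U V : is_cnf U -> is_cnf V -> is_cnf (U `|` V)%classic.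
Proof.
case=> cs -> [cs' ->].
exists [seq ((p.1 `&` q.1)%O, (p.2 `|` q.2)%O) | p <- cs, q <- cs'].
rewrite /clauses; elim: cs => [|p cs IH] /=; first by rewrite !big_nil setTU.
rewrite big_cons setUIl IH big_cat /=; congr (_ `&` _)%classic.
elim: cs' {IH} => [|q cs' IH] /=; first by rewrite !big_nil setUT.
rewrite !big_cons setUIr IH; congr (_ `&` _)%classic.
by rewrite stoneI stoneU setCI setUACA.
Qed.

Let cnf_compl U : is_cnf U -> is_cnf (~` U)%classic.
Proof.
case=> cs ->; elim: cs => [|p cs IH].
  exists [:: (\top, \bot)]; rewrite /clauses big_nil big_seq1 /=.
  by rewrite stone0 stone1 setU0.
rewrite /clauses big_cons setCI; apply: cnf_or => //.
exists [:: (\top, p.1); (p.2, \bot)].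
rewrite /clauses big_cons big_seq1 /= stone0 stone1 setCT set0U setU0.
by rewrite setCU setCK.
Qed.

Lemma in_envelopeP U : in_envelope U -> exists cs, U = clauses cs.
Proof.
elim=> [a|V W _ [cs ->] _ [cs' ->]|V W _ hV _ hW|V _ hV].
- exists [:: (\top, a)].
  by rewrite /clauses big_seq1 /= stone1 setCT set0U.
- by exists (cs ++ cs'); rewrite clauses_cat.
- exact: cnf_or.
- exact: cnf_compl.
Qed.

Lemma stone_le a b : (stone a `<=` stone b)%classic <-> a <= b.
Proof.
split=> [sab|ab]; last by move=> x; apply: pf_le.
apply: contrapT => nab.
pose P (X : set H) := [/\ forall u v, X u -> X v -> X (u `&` v),
  forall u v, u <= v -> X u -> X v, ~ X b & forall u, X u -> X a].
have [F FP totF|F [[FI Fle Fb Fa] Fmax]] := @Zorn_bigcup H P.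
  split=> [u v [X FX Xu] [Y FY Yv]|u v uv [X FX Xu]|[X FX Xb]|u [X FX Xu]].
  - case: (totF X Y FX FY) => XY.
      by exists Y => //; have [+ _ _ _] := FP _ FY; apply=> //; apply: XY.
    by exists X => //; have [+ _ _ _] := FP _ FX; apply=> //; apply: XY.
  - by exists X => //; have [_ + _ _] := FP _ FX; apply; [exact: uv|].
  - by have [_ _ + _] := FP _ FX; apply.
  - by exists X => //; have [_ _ _ +] := FP _ FX; apply; exact: Xu.
have Fa1 : F a.
  apply: contrapT => nFa; apply: (Fmax [set w | (a <= w)%O]%classic).
    split=> [w Fw|/(_ a (lexx a))//]; exact: False_ind (nFa (Fa w Fw)).
  split=> [u v au av|u v uv au||u _] /=; first by rewrite lexI au av.
  - exact: le_trans au uv.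
  - exact: nab.
  - exact: lexx.
have ext c : ~ F c -> exists2 u, F u & u `&` c <= b.
  move=> nFc; apply: contrapT => nex.
  apply: (Fmax [set w | exists2 u, F u & (u `&` c <= w)%O]%classic).
    split=> [w Fw|GF]; first by exists w => //; exact: leIl.
    by apply/nFc/GF; exists a => //; exact: leIr.
  split=> [u v [u' Fu' hu] [v' Fv' hv]|u v uv [u' Fu' hu]|//|u _].
  - exists (u' `&` v'); first exact: FI.
    by rewrite lexI (le_trans _ hu) ?(le_trans _ hv) // leI2 ?leIl ?leIr.
  - by exists u' => //; exact: le_trans hu uv.
  - by exists a => //; exact: leIl.
have Fbot : ~ F \bot by move/Fle => /(_ b (le0x _)).
have Fjoin u v : F (u `|` v) -> F u \/ F v.
  move=> Fuv; apply: contrapT => /not_orP[/ext[w Fw hw] /ext[w' Fw' hw']].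
  apply: Fb; apply: Fle (FI _ _ (FI _ _ Fw Fw') Fuv).
  rewrite meetUr leUx (le_trans _ hw) ?(le_trans _ hw') //;
    by rewrite leI2 ?leIl ?leIr.
pose x := PrimeFilter (Fle a \top (lex1 a) Fa1) Fle FI Fbot Fjoin.
exact: Fb (sab x Fa1).
Qed.

Lemma stone_le_clauses a cs :
  (stone a `<=` clauses cs)%classic <-> a <= clauses_box cs.
Proof.
rewrite /clauses /clauses_box; elim: cs => [|[c e] cs IH].
  by rewrite !big_nil lex1; split=> // _; exact: subsetT.
rewrite !big_cons lexI subsetI IH /= le_himp.
rewrite -(rwP andP); apply: and_iff_compat_r.
rewrite -stone_le stoneI; split=> h x.
  by case=> /h[].
by move=> ax; have [cx|] := pselect (stone c x); [right; apply: h|left].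
Qed.

Lemma clauses_box_inj cs cs' :
  clauses cs = clauses cs' -> clauses_box cs = clauses_box cs'.
Proof.
move=> e; apply: le_anti; apply/andP; split; apply/stone_le_clauses.
  by rewrite -e; apply/stone_le_clauses.
by rewrite e; apply/stone_le_clauses.
Qed.

Record envelope := Envelope {
  env_set : set (prime_filter H);
  _ : env_set \in (in_envelope : set (set (prime_filter H)))
}.

HB.instance Definition _ := [isSub for env_set].
HB.instance Definition _ := [Choice of envelope by <:].

Let env_pred : pred (set (prime_filter H)) := fun U => U \in (in_envelope : set _).

Let env_predI : {in env_pred &, forall U V, U `&` V \in env_pred}.
Proof.
by move=> U V /set_mem hU /set_mem hV; apply: mem_set; exact: in_env_setI.
Qed.

Let env_predU : {in env_pred &, forall U V, U `|` V \in env_pred}.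
Proof.
by move=> U V /set_mem hU /set_mem hV; apply: mem_set; exact: in_env_setU.
Qed.

Let env_pred0 : \bot \in env_pred.
Proof. by apply: mem_set; rewrite -[\bot]stone0; exact: in_env_stone. Qed.

Let env_pred1 : \top \in env_pred.
Proof. by apply: mem_set; rewrite -[\top]stone1; exact: in_env_stone. Qed.

HB.instance Definition _ := Order.SubChoice_isTBSubLattice.Build
  set_display (set (prime_filter H)) _ d envelope
  env_predI env_predU env_pred0 env_pred1.

Lemma env_setI (X Y : envelope) :
  env_set (X `&` Y)%O = (env_set X `&` env_set Y)%classic.
Proof. by []. Qed.

Lemma env_setU (X Y : envelope) :
  env_set (X `|` Y)%O = (env_set X `|` env_set Y)%classic.
Proof. by []. Qed.

Lemma env_set0 : env_set \bot = set0.
Proof. by []. Qed.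

Lemma env_set1 : env_set \top = setT.
Proof. by []. Qed.

Let envelope_meetUl : @left_distributive envelope envelope Order.meet Order.join.
Proof.
by move=> X Y Z; apply: val_inj; exact: setIUl.
Qed.

HB.instance Definition _ :=
  Order.Lattice_Meet_isDistrLattice.Build d envelope envelope_meetUl.

Fact env_compl_subproof (X : envelope) :
  (~` env_set X)%classic \in (in_envelope : set (set (prime_filter H))).
Proof. by case: X => U /= /set_mem hU; apply/mem_set/in_env_setC. Qed.

Definition env_compl (X : envelope) : envelope :=
  Envelope (env_compl_subproof X).

Let env_joinxC X : X `|` env_compl X = \top.
Proof. by apply: val_inj; exact: setUv. Qed.

Let env_meetxC X : X `&` env_compl X = \bot.
Proof. by apply: val_inj; exact: setICr. Qed.

HB.instance Definition _ := Order.TBDistrLattice_hasComplement.Build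
  d envelope env_joinxC env_meetxC.

Fact env_stone_subproof a :
  stone a \in (in_envelope : set (set (prime_filter H))).
Proof. exact/mem_set/in_env_stone. Qed.

Definition env_stone a : envelope := Envelope (env_stone_subproof a).

Lemma env_clausesP (X : envelope) : exists cs, env_set X = clauses cs.
Proof. by case: X => U /= /set_mem; exact: in_envelopeP. Qed.

(* The value of the box is read off an arbitrarily chosen representation of the
   element as a meet of clauses; [env_boxE] shows that the choice is
   irrelevant. *)
Definition env_box (X : envelope) : envelope :=
  env_stone (clauses_box (projT1 (cid (env_clausesP X)))).

Lemma env_boxE (X : envelope) cs :
  env_set X = clauses cs -> env_box X = env_stone (clauses_box cs).
Proof.
move=> Xcs; rewrite /env_box; case: cid => cs' /= Xcs'.
by rewrite (@clauses_box_inj cs' cs) // -Xcs'.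
Qed.

Lemma le_envP X Y : reflect (env_set X `<=` env_set Y)%classic (X <= Y).
Proof. exact: asboolP. Qed.

Lemma le_env_box a X : (env_stone a <= env_box X) = (env_stone a <= X).
Proof.
have [cs Xcs] := env_clausesP X; rewrite (env_boxE Xcs).
apply/le_envP/le_envP; rewrite Xcs /=.
  by move=> /stone_le /stone_le_clauses.
by move=> /stone_le_clauses /stone_le.
Qed.

Let env_boxW X : env_box X <= X.
Proof. by rewrite -le_env_box. Qed.

Let env_box_le_box X : env_box X <= env_box (env_box X).
Proof. by rewrite [leLHS]/env_box !le_env_box -/(env_box X). Qed.

Let env_box1 : env_box \top = \top.
Proof.
apply/eqP; rewrite eq_le lex1 /=.
have -> : \top = env_stone \top by apply: val_inj; exact/esym/stone1.
by rewrite le_env_box.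
Qed.

Let env_boxI X Y : env_box (X `&` Y) = env_box X `&` env_box Y.
Proof.
have [cs Xcs] := env_clausesP X; have [cs' Ycs'] := env_clausesP Y.
have XY : env_set (X `&` Y)%O = clauses (cs ++ cs').
  by rewrite clauses_cat -Xcs -Ycs' env_setI.
rewrite (env_boxE Xcs) (env_boxE Ycs') (env_boxE XY) /clauses_box big_cat.
by apply: val_inj; exact: stoneI.
Qed.

HB.instance Definition _ := CTBDistrLattice_isS4.Build
  d envelope env_box1 env_boxI env_boxW env_box_le_box.

Lemma env_setC (X : envelope) : env_set (~` X)%O = (~` env_set X)%classic.
Proof. by []. Qed.

Lemma envelope_boxE (X : envelope) cs :
  env_set X = clauses cs -> env_set (box X) = stone (clauses_box cs).
Proof. by move=> /env_boxE eX; rewrite -[box X]/(env_box X) eX. Qed.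

End Envelope.

(** * Class operators *)

(* Classes of algebras are plain predicates: [s4AlgType d] is too large, as a
   type, to be an argument of [set]. *)
Section Classes.
Variable d : Order.disp_t.
Implicit Types (A B : s4AlgType d) (H : heytingType d).
Implicit Types (K : s4AlgType d -> Prop) (P : heytingType d -> Prop).

Definition Hom_images K A : Prop :=
  exists2 B, K B & exists f : B -> A,
    s4_hom f /\ forall a, exists b, f b = a.

Definition Subalgebras K A : Prop :=
  exists2 B, K B & exists f : A -> B, s4_hom f /\ injective f.

(* [A] is isomorphic to the product of the family [B]. *)
Definition Products K A : Prop :=
  exists (I : Type) (B : I -> s4AlgType d),
    (forall i, K (B i)) /\
    exists f : forall i, A -> B i,
      (forall i, s4_hom (f i)) /\
      bijective ((fun a i => f i a) : A -> forall i, B i).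

Definition HSP K := Hom_images (Subalgebras (Products K)).

Definition variety K :=
  [/\ forall A, Hom_images K A -> K A,
      forall A, Subalgebras K A -> K A &
      forall A, Products K A -> K A].

Definition rho K H : Prop := exists2 B, K B & heyting_iso H (opens B).

Definition sigma P : s4AlgType d -> Prop :=
  HSP (fun A => exists2 H, P H & A = envelope H).

End Classes.

(** * Formulas and logics *)

Inductive modal :=
| MVar of nat | MTop | MBot | MNeg of modal
| MAnd of modal & modal | MOr of modal & modal | MBox of modal.

Inductive ipc :=
| IVar of nat | ITop | IBot
| IAnd of ipc & ipc | IOr of ipc & ipc | IImp of ipc & ipc.

Definition MImp p q := MOr (MNeg p) q.

Fixpoint msubst (s : nat -> modal) (p : modal) : modal :=
  match p with
  | MVar n => s n
  | MTop => MTop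
  | MBot => MBot
  | MNeg p => MNeg (msubst s p)
  | MAnd p q => MAnd (msubst s p) (msubst s q)
  | MOr p q => MOr (msubst s p) (msubst s q)
  | MBox p => MBox (msubst s p)
  end.

Fixpoint GMT (p : ipc) : modal :=
  match p with
  | IVar n => MBox (MVar n)
  | ITop => MTop
  | IBot => MBot
  | IAnd p q => MAnd (GMT p) (GMT q)
  | IOr p q => MOr (GMT p) (GMT q)
  | IImp p q => MBox (MOr (MNeg (GMT p)) (GMT q))
  end.

Fixpoint meval d (B : s4AlgType d) (v : nat -> B) (p : modal) : B :=
  match p with
  | MVar n => v n
  | MTop => \top
  | MBot => \bot
  | MNeg p => ~` meval v p
  | MAnd p q => meval v p `&` meval v q
  | MOr p q => meval v p `|` meval v q
  | MBox p => box (meval v p)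
  end.

Definition Log d (K : s4AlgType d -> Prop) : set modal :=
  [set p | forall B, K B -> forall v : nat -> B, meval v p = \top]%classic.

(* Two-valued evaluation in which boxed formulas are treated as atoms *)
Fixpoint beval (v : modal -> bool) (p : modal) : bool :=
  match p with
  | MVar _ | MBox _ => v p
  | MTop => true
  | MBot => false
  | MNeg p => ~~ beval v p
  | MAnd p q => beval v p && beval v q
  | MOr p q => beval v p || beval v q
  end.

Inductive S4 : set modal :=
| S4_taut p : (forall v, beval v p) -> S4 p
| S4_K p q : S4 (MImp (MBox (MImp p q)) (MImp (MBox p) (MBox q)))
| S4_T p : S4 (MImp (MBox p) p)
| S4_4 p : S4 (MImp (MBox p) (MBox (MBox p)))
| S4_mp p q : S4 (MImp p q) -> S4 p -> S4 q
| S4_nec p : S4 p -> S4 (MBox p).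

Section Logics.
Local Open Scope classical_set_scope.
Implicit Types (L M : set modal) (I : set ipc).

Definition NExtS4 L :=
  [/\ S4 `<=` L,
      forall p q, L (MImp p q) -> L p -> L q,
      forall p, L p -> L (MBox p) &
      forall s p, L p -> L (msubst s p)].

Definition box_variant L : set modal :=
  [set p | L (msubst (fun q => MBox (MVar q)) p)].

Definition Schem L : set modal := [set p | forall s, L (msubst s p)].

Definition box_maximal L :=
  forall S, NExtS4 S -> box_variant L = box_variant S -> S `<=` L.

Definition rho_logic L : set ipc := [set p | L (GMT p)].

Definition modal_companion I M := forall p, I p <-> M (GMT p).

Definition greatest_modal_companion I L :=
  [/\ NExtS4 L, modal_companion I L &
      forall M, NExtS4 M -> modal_companion I M -> M `<=` L].

End Logics.

(* Main.v *)
(* For the first part, let H be isomorphic to the open elements of B in K.  The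
   isomorphism extends to an S4-embedding of the envelope of H into B, because
   an inclusion between clauses over H unfolds into inequalities in H.  Since
   the envelope is generated, as a Boolean algebra, by H, a valuation into it
   is a substitution followed by a valuation in H; so a formula is valid in the
   envelope iff all its substitution instances hold in B under all valuations
   by open elements.

   For the second part, when the variables of p are boxed, p is S4-equivalent
   to a conjunction of clauses [~ GMT c \/ GMT d], and its box to the
   translation of the conjunction of the [c -> d].  Hence the box-variant of a
   logic L and rho L determine each other. *)
Require Import Defs.
From mathcomp Require Import all_boot all_order.
From mathcomp Require Import boolp classical_sets.

Set Implicit Arguments.
Unset Strict Implicit.
Unset Printing Implicit Defensive.

Import Order.Theory.
Local Open Scope order_scope.

(** * Evaluation of modal formulas *)

Lemma meval_msubst d (B : s4AlgType d) (v : nat -> B) s p :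
  meval v (msubst s p) = meval (fun n => meval v (s n)) p.
Proof.
by elim: p => //= [p ->|p -> q ->|p -> q ->|p ->].
Qed.

Lemma s4_hom_meval d d' (A : s4AlgType d) (B : s4AlgType d') (f : A -> B)
    (v : nat -> A) p :
  s4_hom f -> f (meval v p) = meval (fun n => f (v n)) p.
Proof.
case=> [[f0 f1] fI fU fC fB].
by elim: p => //= [p <-|p <- q <-|p <- q <-|p <-].
Qed.

Lemma s4_hom_id d (A : s4AlgType d) : s4_hom (@id A).
Proof. by split. Qed.

(** * Validity in generated varieties *)

Section ClassLogic.
Variable d : Order.disp_t.
Implicit Types (K : s4AlgType d -> Prop) (A : s4AlgType d).

Lemma subset_HSP K A : K A -> HSP K A.
Proof.
move=> KA; exists A; last by exists id; split; [exact: s4_hom_id|move=> a; exists a].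
exists A; last by exists id; split; [exact: s4_hom_id|exact: inj_id].
exists unit, (fun=> A); split=> //; exists (fun=> id); split.
  by move=> _; exact: s4_hom_id.
by exists (fun g => g tt) => // g; apply/funext => -[].
Qed.

(** A valuation in a homomorphic image lifts along the surjection; the lifted one is pushed along
    the embedding into the product, where validity is checked coordinatewise. *)
Lemma Log_HSP K : Log (HSP K) = Log K.
Proof.
apply/seteqP; split=> p Kp A; first by move=> KA; apply/Kp/subset_HSP.
move=> [B [C [I [D [KD [g [gH g_bij]]]]] [h [hH h_inj]]] [f [fH f_sur]]] v.
have [w wE] : exists w : nat -> B, forall n, f (w n) = v n.
  by exists (fun n => projT1 (cid (f_sur (v n)))) => n; case: cid.
have -> : v = fun n => f (w n) by apply/funext => n; rewrite wE.
rewrite -s4_hom_meval //; have [[_ <-] _ _ _ _] := fH; congr f.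
apply: h_inj; rewrite s4_hom_meval //; have [[_ ->] _ _ _ _] := hH.
apply: (bij_inj g_bij); apply: functional_extensionality_dep => i.
by rewrite s4_hom_meval //; have [[_ ->] _ _ _ _] := gH i; apply: Kp.
Qed.

End ClassLogic.

(** * Embedding an envelope *)

Lemma env_stone_generates d (H : heytingType d) (v : nat -> envelope H) :
  exists (w : nat -> H) s,
    v = fun n => meval (fun k => env_stone (w k)) (s n).
Proof.
have gen cs : exists (w : nat -> H) p,
    env_set (meval (fun k => env_stone (w k)) p) = clauses cs.
  elim: cs => [|[a b] cs [w [p wp]]].
    by exists (fun=> \bot), MTop; rewrite /clauses big_nil.
  (* The new generators [a] and [b] take indices 0 and 1, so the variables of [p] shift by two. *)
  exists (fun k => if k is j.+1 then (if j is i.+1 then w i else b) else a).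
  exists (MAnd (MOr (MNeg (MVar 0)) (MVar 1)) (msubst (fun j => MVar j.+2) p)).
  rewrite [LHS]env_setI [env_set (meval _ (msubst _ _))](_ : _ = clauses cs).
    by rewrite /clauses big_cons.
  by rewrite meval_msubst.
have genv n : exists wp : (nat -> H) * modal,
    v n = meval (fun k => env_stone (wp.1 k)) wp.2.
  have [cs vcs] := env_clausesP (v n); have [w [p wp]] := gen cs.
  by exists (w, p); apply: val_inj; rewrite /= vcs wp.
have [g gE] := choice genv.
(* Each [v n] has its own generators; coding pairs merges them into one valuation. The default
   [\bot] is never read, as the substitution uses only codes of pairs. *)
exists (fun k => if unpickle k is Some (n, j) then (g n).1 j else \bot).
exists (fun n => msubst (fun j => MVar (pickle (n, j))) (g n).2).
apply/funext => n; rewrite gE meval_msubst; congr meval.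
by apply/funext => j /=; rewrite pickleK.
Qed.

Section EnvelopeEmbedding.
Variables (d d' : Order.disp_t) (H : heytingType d) (B : s4AlgType d').
Variable f : H -> opens B.
Hypotheses (fH : heyting_hom f) (f_inj : injective f).
Implicit Types (a b : H) (cs : seq (H * H)) (X Y : envelope H).

Let g a : B := \val (f a).

Let g0 : g \bot = \bot. Proof. by rewrite /g; have [[-> _] _ _ _] := fH. Qed.
Let g1 : g \top = \top. Proof. by rewrite /g; have [[_ ->] _ _ _] := fH. Qed.
Let gI a b : g (a `&` b) = g a `&` g b.
Proof. by rewrite /g; have [_ -> _ _] := fH. Qed.
Let gU a b : g (a `|` b) = g a `|` g b.
Proof. by rewrite /g; have [_ _ -> _] := fH. Qed.
Let gimp a b : g (himp a b) = box (~` g a `|` g b).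
Proof. by rewrite /g; have [_ _ _ ->] := fH. Qed.

Let g_le a b : (g a <= g b) = (a <= b).
Proof. by rewrite !leEmeet -gI (inj_eq (inj_comp val_inj f_inj)). Qed.

Definition clauses_val cs : B := \meet_(cd <- cs) (~` g cd.1 `|` g cd.2).

Lemma clauses_val_stone a : clauses_val [:: (\top, a)] = g a.
Proof. by rewrite /clauses_val big_seq1 /= g1 compl1 join0x. Qed.

Lemma clauses_stone a : clauses [:: (\top : H, a)] = stone a.
Proof. by rewrite /clauses big_seq1 /= stone1 setCT set0U. Qed.

(** A clause [~c \/ e] on the left splits the inequality in two: [c] joins the right side or [e]
    meets the left side. Hence [a] and [b] vary in the induction, which ends with an inequality in
    [H], respected and reflected by both [stone] and [g]. *)
Lemma le_clauses_val a b cs :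
  (stone a `&` clauses cs `<=` stone b)%classic <->
  g a `&` clauses_val cs <= g b.
Proof.
rewrite /clauses_val; elim: cs a b => [|[c e] cs IH] a b.
  by rewrite /clauses !big_nil setIT meetx1 g_le stone_le.
rewrite /clauses !big_cons -/(clauses cs) /=.
set C := \big[_/_]_(_ <- _) _.
have -> : (g a `&` ((~` g c `|` g e) `&` C) <= g b)
    = (g a `&` C <= g (b `|` c)) && (g (a `&` e) `&` C <= g b).
  have -> : g a `&` ((~` g c `|` g e) `&` C)
      = (g a `&` C) `&` ~` g c `|` g (a `&` e) `&` C.
    by rewrite gI [_ `&` C in LHS]meetC meetA meetUr [_ `&` g e `&` C]meetAC.
  by rewrite leUx -diffE leBLR gU joinC.
rewrite -(rwP andP) -!IH stoneI stoneU; split=> [h|[hc he] x [xa [[xc|xe] xC]]].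
- split=> [x [xa xC]|x [[xa xe] xC]]; last by apply: h; split=> //; split=> //; right.
  have [xc|xc] := pselect (stone c x); first by right.
  by left; apply: h; split=> //; split=> //; left.
- by have [|//|/xc] := hc x.
- by apply: he; do !split.
Qed.

(** Makes [env_val] below both independent of the chosen clauses and an order embedding. *)
Lemma clauses_val_subset cs cs' :
  (clauses cs `<=` clauses cs')%classic <-> clauses_val cs <= clauses_val cs'.
Proof.
elim: cs' => [|[c e] cs' IH].
  by rewrite /clauses /clauses_val !big_nil lex1; split=> // _ x.
rewrite [clauses (_ :: _)]big_cons [clauses_val (_ :: _)]big_cons.
rewrite subsetI IH lexI -(rwP andP) /=.
apply: and_iff_compat_r.
have -> : (clauses_val cs <= ~` g c `|` g e) = (g c `&` clauses_val cs <= g e).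
  by rewrite meetC -leBLR diffE complK.
rewrite -le_clauses_val; split=> [h x [xc /h[]//]|h x xC].
by have [xc|] := pselect (stone c x); [right; apply: h|left].
Qed.

Definition env_val X : B := clauses_val (projT1 (cid (env_clausesP X))).

Lemma env_valE X cs : env_set X = clauses cs -> env_val X = clauses_val cs.
Proof.
rewrite /env_val; case: cid => cs' /= -> e.
by apply: le_anti; apply/andP; split; apply/clauses_val_subset; rewrite e.
Qed.

Lemma env_val_le X Y : (env_val X <= env_val Y) = (X <= Y).
Proof.
have [cs Xcs] := env_clausesP X; have [cs' Ycs'] := env_clausesP Y.
rewrite (env_valE Xcs) (env_valE Ycs').
by apply/idP/le_envP; rewrite Xcs Ycs' clauses_val_subset.
Qed.

Lemma env_val_inj : injective env_val.
Proof. by move=> X Y e; apply: le_anti; rewrite -!env_val_le e lexx. Qed.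

Lemma env_val_stone a : env_val (env_stone a) = \val (f a).
Proof. by rewrite (@env_valE _ [:: (\top, a)]) ?clauses_val_stone ?clauses_stone. Qed.

Let env_val0 : env_val \bot = \bot.
Proof.
have -> : \bot = env_stone (\bot : H) by apply: val_inj; exact/esym/stone0.
by rewrite env_val_stone -/(g _).
Qed.

Let env_val1 : env_val \top = \top.
Proof.
have -> : \top = env_stone (\top : H) by apply: val_inj; exact/esym/stone1.
by rewrite env_val_stone -/(g _).
Qed.

Let env_valI X Y : env_val (X `&` Y) = env_val X `&` env_val Y.
Proof.
have [cs Xcs] := env_clausesP X; have [cs' Ycs'] := env_clausesP Y.
rewrite (env_valE Xcs) (env_valE Ycs') (@env_valE _ (cs ++ cs')) //.
  exact: big_cat.
by rewrite clauses_cat -Xcs -Ycs'.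
Qed.

(* If [(c, e)] is a clause of the complement of X, then [c `&` ~` e] lies below
   every clause of X, which is an inequality between elements of H. *)
Let env_valU1 X : env_val X `|` env_val (~` X) = \top.
Proof.
have [cs Xcs] := env_clausesP X; have [cs' Ycs'] := env_clausesP (~` X).
rewrite (env_valE Xcs) (env_valE Ycs').
have : (~` clauses cs `<=` clauses cs')%classic by rewrite -Xcs -Ycs'.
elim: cs' {Ycs'} => [|[c e] cs' IH].
  by rewrite [clauses_val [::]]big_nil joinx1.
rewrite [clauses (_ :: _)]big_cons [clauses_val (_ :: _)]big_cons /=.
rewrite subsetI joinIr => -[h /IH ->]; rewrite meetx1.
elim: cs {Xcs IH} h => [|[a b] cs IH].
  by rewrite [clauses_val [::]]big_nil join1x.
rewrite [clauses (_ :: _)]big_cons [clauses_val (_ :: _)]big_cons /=.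
rewrite setCI subUset joinIl => -[h /IH ->]; rewrite meetx1.
have ac_be : a `&` c <= b `|` e.
  apply/stone_le; rewrite stoneI stoneU => x [xa xc].
  have [xb|xb] := pselect (stone b x); [by left|right].
  by have [[]||] := h x.
apply/eqP; rewrite eq_le lex1 joinACA -complI -gI -gU /=.
by rewrite -(joinCx (g (a `&` c))) leU2 // g_le.
Qed.

(** Complements are unique: meets are preserved, and [env_valU1] supplies the join. Joins then
    follow by De Morgan. *)
Let env_valC X : env_val (~` X) = ~` env_val X.
Proof.
have eI : env_val (~` X) `&` env_val X == \bot.
  by rewrite -env_valI meetCx env_val0.
apply: le_anti; rewrite -disj_leC eI /= complEdiff leBLR.
by rewrite env_valU1.
Qed.

Let env_valU X Y : env_val (X `|` Y) = env_val X `|` env_val Y.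
Proof.
by rewrite -[X `|` Y]complK complU env_valC env_valI !env_valC complI !complK.
Qed.

(** On clauses the box is a meet of Heyting implications; [f] turns each into the box of a clause,
    and box distributes over meets. *)
Let env_valB X : env_val (box X) = box (env_val X).
Proof.
have [cs Xcs] := env_clausesP X; rewrite (env_valE Xcs).
have -> : box X = env_stone (clauses_box cs).
  by apply: val_inj; exact: envelope_boxE.
rewrite env_val_stone -/(g _) /clauses_box /clauses_val.
by elim: cs {Xcs} => [|cd cs IH]; rewrite ?big_nil ?box1 // !big_cons gI gimp boxI IH.
Qed.

Lemma env_val_hom : s4_hom env_val.
Proof. by split. Qed.

End EnvelopeEmbedding.

(** * The logic of the envelopes *)

Lemma Log_sigma_rho d (K : s4AlgType d -> Prop) :
  Log (sigma (rho K)) = Schem (box_variant (Log K)).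
Proof.
rewrite /sigma Log_HSP; apply/seteqP; split=> p.
- move=> vp s B KB v; rewrite meval_msubst.
  (* The algebra [opens B] is itself in [rho K], and its envelope embeds into [B] with every
     [box (v n)] in the image. *)
  have ho : heyting_hom (@id (opens B)) by split.
  have ob n : box (v n) == box (box (v n)) by rewrite box_idem.
  have -> : (fun n => meval v (MBox (MVar n)))
      = fun n => env_val id (env_stone (Opens (ob n))).
    by apply/funext => n; rewrite env_val_stone.
  have eH := env_val_hom ho (@inj_id _); have [[_ <-] _ _ _ _] := eH.
  rewrite -s4_hom_meval // meval_msubst vp //; exists (opens B) => //.
  by exists B => //; exists id => //; exists id.
- move=> sp _ [H [B KB [f fH f_bij]] ->] v.
  have [w [s ->]] := env_stone_generates v.
  have f_inj := bij_inj f_bij.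
  have eH := env_val_hom fH f_inj; apply: (env_val_inj fH f_inj).
  rewrite -meval_msubst s4_hom_meval //; have [[_ ->] _ _ _ _] := eH.
  (* The values [\val (f (w n))] are fixed by box, so boxing the variables leaves the evaluation
     unchanged. *)
  rewrite -[RHS](sp s B KB (fun n => \val (f (w n)))) [RHS]meval_msubst.
  congr meval; apply/funext => n; rewrite env_val_stone //=.
  by case: (f (w n)) => a /= /eqP.
Qed.

(** * Normal forms of formulas with boxed variables *)

(** Since [beval] treats boxed formulas as atoms, propositional steps in [S4] reduce to truth
    tables. *)
Lemma S4_conseq p q : (forall v, beval v p -> beval v q) -> S4 p -> S4 q.
Proof.
by move=> pq; apply: S4_mp; apply: S4_taut => v /=; rewrite -implybE; apply/implyP/pq.
Qed.

Lemma S4_conseq2 p q r :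
  (forall v, beval v p -> beval v q -> beval v r) -> S4 p -> S4 q -> S4 r.
Proof.
move=> pqr Sp; apply: S4_mp; apply: S4_conseq Sp => v vp /=.
by rewrite -implybE; apply/implyP/pqr.
Qed.

Definition MIff p q := MAnd (MImp p q) (MImp q p).

Lemma beval_MIff v p q : beval v (MIff p q) = (beval v p == beval v q).
Proof. by rewrite /=; case: beval; case: beval. Qed.

Lemma S4_box_mono p q : S4 (MImp p q) -> S4 (MImp (MBox p) (MBox q)).
Proof. by move/S4_nec; apply/S4_mp/S4_K. Qed.

Lemma S4_box_iff p q : S4 (MIff p q) -> S4 (MIff (MBox p) (MBox q)).
Proof.
move=> pq; apply: (@S4_conseq2 (MImp (MBox p) (MBox q)) (MImp (MBox q) (MBox p))).
- by move=> v /= -> ->.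
- by apply: S4_box_mono; apply: S4_conseq pq => v /= /andP[].
- by apply: S4_box_mono; apply: S4_conseq pq => v /= /andP[].
Qed.

Lemma S4_iff_trans p q r : S4 (MIff p q) -> S4 (MIff q r) -> S4 (MIff p r).
Proof. by apply: S4_conseq2 => v; rewrite !beval_MIff => /eqP ->. Qed.

Lemma S4_boxI p q :
  S4 (MIff (MBox (MAnd p q)) (MAnd (MBox p) (MBox q))).
Proof.
have Sp : S4 (MImp (MBox (MAnd p q)) (MBox p)).
  by apply/S4_box_mono/S4_taut => v /=; case: beval; case: beval.
have Sq : S4 (MImp (MBox (MAnd p q)) (MBox q)).
  by apply/S4_box_mono/S4_taut => v /=; case: beval; case: beval.
have Spq : S4 (MImp (MBox p) (MBox (MImp q (MAnd p q)))).
  by apply/S4_box_mono/S4_taut => v /=; case: beval; case: beval.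
have Spq' : S4 (MImp (MBox p) (MImp (MBox q) (MBox (MAnd p q)))).
  apply: S4_conseq2 (S4_K q (MAnd p q)) Spq => v /=.
  by do 4!case: (v _).
apply: S4_conseq2 Spq'; last first.
  apply: (@S4_conseq2 _ _ (MImp (MBox (MAnd p q)) (MAnd (MBox p) (MBox q)))) Sp Sq.
  by move=> v /=; do 3!case: (v _).
by move=> v /=; do 3!case: (v _).
Qed.

(** Syntactic analogue of [clauses]; [ipc_clauses] plays the part of [clauses_box]. *)
Definition gmt_clauses (cs : seq (ipc * ipc)) : modal :=
  foldr (fun cd => MAnd (MImp (GMT cd.1) (GMT cd.2))) MTop cs.

Definition ipc_clauses (cs : seq (ipc * ipc)) : ipc :=
  foldr (fun cd => IAnd (IImp cd.1 cd.2)) ITop cs.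

Lemma beval_gmt_clauses v cs :
  beval v (gmt_clauses cs)
  = all (fun cd => beval v (GMT cd.1) ==> beval v (GMT cd.2)) cs.
Proof. by elim: cs => //= cd cs ->; rewrite implybE. Qed.

Lemma S4_box_gmt_clauses cs :
  S4 (MIff (MBox (gmt_clauses cs)) (GMT (ipc_clauses cs))).
Proof.
elim: cs => [|cd cs IH] /=.
  apply: S4_conseq (S4_nec (S4_taut (p := MTop) _)) => // v.
  by rewrite beval_MIff => /eqP.
apply: S4_iff_trans (S4_boxI _ _) _; apply: S4_conseq IH => v.
by rewrite !beval_MIff /= => /eqP ->.
Qed.

(** Distributivity: the disjunction of [a -> b] and [a' -> b'] is classically the clause from
    [a /\ a'] to [b \/ b'], and [GMT] commutes with both connectives. *)
Lemma gmt_clauses_or cs cs' :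
  exists cs'', forall v, beval v (gmt_clauses cs'')
    = beval v (gmt_clauses cs) || beval v (gmt_clauses cs').
Proof.
exists [seq (IAnd p.1 q.1, IOr p.2 q.2) | p <- cs, q <- cs'] => v.
rewrite !beval_gmt_clauses; elim: cs => [|[a b] cs IH] //=.
rewrite all_cat IH all_map orb_andl; congr (_ && _).
elim: cs' {IH} => [|[a' b'] cs' IH] /=; first by rewrite orbT.
rewrite IH orb_andr; congr (_ && _).
by do 4!case: beval.
Qed.

Lemma gmt_clauses_neg cs :
  exists cs', forall v, beval v (gmt_clauses cs') = ~~ beval v (gmt_clauses cs).
Proof.
elim: cs => [|[a b] cs [cs' IH]]; first by exists [:: (ITop, IBot)].
(* The two listed clauses say [a] and not [b], the negation of the clause [(a, b)]. *)
have [cs'' h] := gmt_clauses_or [:: (ITop, a); (b, IBot)] cs'.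
exists cs'' => v; rewrite h IH /=.
by do 3!case: beval.
Qed.

Lemma gmt_clauses_cat cs cs' v :
  beval v (gmt_clauses (cs ++ cs'))
  = beval v (gmt_clauses cs) && beval v (gmt_clauses cs').
Proof. by rewrite !beval_gmt_clauses all_cat. Qed.

Definition box_vars := msubst (fun q => MBox (MVar q)).

Lemma gmt_clauses_exist p : exists cs, S4 (MIff (box_vars p) (gmt_clauses cs)).
Proof.
elim: p => [n|||p [cs IH]|p [cs IH] q [cs' IH']|p [cs IH] q [cs' IH']|p [cs IH]].
- exists [:: (ITop, IVar n)]; apply: S4_taut => v.
  by rewrite beval_MIff /= andbT.
- by exists [::]; apply: S4_taut.
- by exists [:: (ITop, IBot)]; apply: S4_taut.
- have [cs' h] := gmt_clauses_neg cs; exists cs'; apply: S4_conseq IH => v.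
  by rewrite !beval_MIff h /= => /eqP ->.
- exists (cs ++ cs'); apply: S4_conseq2 IH IH' => v.
  by rewrite !beval_MIff gmt_clauses_cat /= => /eqP -> /eqP ->.
- have [cs'' h] := gmt_clauses_or cs cs'; exists cs''.
  apply: S4_conseq2 IH IH' => v.
  by rewrite !beval_MIff h /= => /eqP -> /eqP ->.
(* The boxed normal form is itself a translation, hence a single clause with premise [ITop]. *)
- exists [:: (ITop, ipc_clauses cs)].
  apply: S4_iff_trans (S4_box_iff IH) _.
  apply: S4_conseq (S4_box_gmt_clauses cs) => v.
  by rewrite !beval_MIff /= andbT.
Qed.

(** By necessitation and the T axiom, a formula may be replaced by its box, which is equivalent to a
    translation. As [phi] is chosen before [L], it serves to compare two logics. *)
Lemma box_vars_GMT p :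
  exists phi, forall L, NExtS4 L -> L (box_vars p) <-> L (GMT phi).
Proof.
have [cs h] := gmt_clauses_exist p; exists (ipc_clauses cs) => L [SL mp nec _].
have {h} := S4_iff_trans (S4_box_iff h) (S4_box_gmt_clauses cs).
move=> h; split.
  move/nec; apply: mp; apply: SL; apply: S4_conseq h => v /=.
  by case/andP.
have : S4 (MImp (GMT (ipc_clauses cs)) (MBox (box_vars p))).
  by apply: S4_conseq h => v /= /andP[].
by move=> /SL /mp i /i; apply: mp; apply/SL/S4_T.
Qed.

Lemma GMT_box_vars phi : exists p, GMT phi = box_vars p.
Proof.
elim: phi => [n|||a [p pE] b [q qE]|a [p pE] b [q qE]|a [p pE] b [q qE]];
  rewrite /= ?pE ?qE.
- by exists (MVar n).
- by exists MTop.
- by exists MBot.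
- by exists (MAnd p q).
- by exists (MOr p q).
- by exists (MBox (MImp p q)).
Qed.

(** * Box-variants and modal companions *)

Lemma box_variant_rho_logic L M : NExtS4 L -> NExtS4 M ->
  box_variant L = box_variant M <-> rho_logic L = rho_logic M.
Proof.
move=> NL NM; split=> e; apply/funext => p; apply/propext.
  have [q qE] := GMT_box_vars p; rewrite /rho_logic /= qE.
  by have := congr1 (@^~ q) e; rewrite /box_variant /= => ->.
have [phi phiE] := box_vars_GMT p.
rewrite /box_variant /= -/box_vars !phiE //.
by have := congr1 (@^~ phi) e; rewrite /rho_logic /= => ->.
Qed.

(** A companion of [rho_logic L] is a logic with the same [rho_logic], hence the same box-variant,
    so both maximality conditions range over the same logics. *)
Lemma box_maximal_greatest_companion L : NExtS4 L ->
  box_maximal L <-> greatest_modal_companion (rho_logic L) L.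
Proof.
move=> NL; have compE M : modal_companion (rho_logic L) M
    <-> rho_logic L = rho_logic M.
  split=> [h|e phi]; first by apply/funext => phi; apply/propext/h.
  by have := congr1 (@^~ phi) e; rewrite {2}/rho_logic /= => ->.
split=> [Lmax|[_ _ Lmax] S NS /box_variant_rho_logic e].
  split=> // M NM /compE /box_variant_rho_logic e.
  by apply: Lmax => //; apply: e.
by apply: Lmax => //; apply/compE/e.
Qed.

Theorem corollary6p8 (d : Order.disp_t) :
  (forall K : s4AlgType d -> Prop, variety K ->
     Log (sigma (rho K)) = Schem (box_variant (Log K))) /\
  (forall L : set modal, NExtS4 L ->
     (box_maximal L <-> greatest_modal_companion (rho_logic L) L)).
Proof.
split=> [K _|]; first exact: Log_sigma_rho.
exact: box_maximal_greatest_companion.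
Qed.
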